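(* Let $G=(V,E)$ be a finite simple graph. Then $$Sb_2(G)\le \min\{\deg(u)+\deg(v)+\deg(w)-\sigma(u,v,w)\},$$ where the minimum is taken over all sets $\{u,v,w\}\subseteq V$ of three vertices such that $v$ is adjacent to both $u$ and $w$, and $\sigma(u,v,w)$ is the number of edges of the subgraph induced on $\{u,v,w\}$.
   Context: $\gamma(G)$ is the domination number of $G$ (minimum size of a dominating set). $Sb_2(G)$ is the minimum size of a set $\mathcal{E}\subseteq E$ such that $\gamma(G-\mathcal{E})=\gamma(G)+2$. *)

(* Defs.v *)
From HB Require Import structures.
From mathcomp Require Import all_boot all_order all_algebra.
From mathcomp Require Import constructive_ereal.

Set Implicit Arguments.
Unset Strict Implicit.
Unset Printing Implicit Defensive.

Record sgraph := SGraph {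
  vertex :> finType;
  adj : rel vertex;
  adj_sym : symmetric adj;
  adj_irrefl : irreflexive adj }.

Definition edges (G : sgraph) : {set {set G}} :=
  [set [set x; y] | x : G, y : G in adj x].

Section DeleteEdges.
Variables (G : sgraph) (F : {set {set G}}).

Definition del_adj : rel G := [rel x y | adj x y && ([set x; y] \notin F)].

Lemma del_adj_sym : symmetric del_adj.
Proof. by move=> x y; rewrite /del_adj /= adj_sym setUC. Qed.

Lemma del_adj_irrefl : irreflexive del_adj.
Proof. by move=> x; rewrite /del_adj /= adj_irrefl. Qed.

Definition del_edges : sgraph := SGraph del_adj_sym del_adj_irrefl.

End DeleteEdges.

Definition deg (G : sgraph) (v : G) : nat := #|[set x | adj v x]|.

Definition dominating (G : sgraph) (D : {set G}) : bool :=
  [forall x, (x \notin D) ==> [exists y in D, adj x y]].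

(* The default setT of arg min is itself dominating, so this is a genuine
   minimum. *)
Definition gamma (G : sgraph) : nat :=
  #|[arg min_(D < [set: G] | dominating D) #|D|]|.

(* Minima are taken in \bar int, where the minimum of an empty family is +oo:
   Sb2 G = +oo exactly when no set of edges raises gamma by 2. *)
Definition Sb2 (G : sgraph) : \bar int :=
  \big[mine/+oo%E]_(F : {set {set G}} |
      (F \subset edges G) && (gamma (del_edges F) == gamma G + 2))
    (Posz #|F|)%:E.

Definition sigma (G : sgraph) (u v w : G) : nat :=
  #|[set f in edges G | f \subset [set u; v; w]]|.

(* Main.v *)
(** Deleting every edge that meets {u, v, w} isolates these three vertices, so
    every dominating set of the remaining graph contains them; replacing the
    three by v alone dominates G, and gamma has grown by at least 2.  Since
    deleting a single edge raises gamma by at most 1, some subset of the deleted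
    edges raises it by exactly 2.  Finally, an edge meets {u, v, w} in two
    vertices when it lies inside and in one when it merely touches it, so double
    counting bounds the number of deleted edges. *)
Require Import Defs.
From mathcomp Require Import all_boot all_order all_algebra.
From mathcomp Require Import constructive_ereal.

Set Implicit Arguments.
Unset Strict Implicit.
Unset Printing Implicit Defensive.

Import Order.TTheory GRing.Theory Num.Theory.

Section Domination.
Variable G : sgraph.
Implicit Types (D S f : {set G}).

Lemma dominatingP D :
  reflect (forall x, x \notin D -> exists2 y, y \in D & adj x y)
          (dominating D).
Proof.
apply: (iffP forall_inP) => domD x xD; first exact/exists_inP/domD.
by apply/exists_inP/domD.
Qed.

Lemma dominatingT : dominating [set: G].
Proof. by apply/dominatingP => x; rewrite inE. Qed.

Lemma gamma_leq D : dominating D -> gamma G <= #|D|.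
Proof.
move=> domD; rewrite /gamma; case: arg_minnP => [|D' _]; last exact.
exact: dominatingT.
Qed.

Lemma gamma_witness : exists2 D : {set G}, dominating D & #|D| = gamma G.
Proof.
rewrite /gamma; case: arg_minnP => [|D domD _]; first exact: dominatingT.
by exists D.
Qed.

Lemma edgesP f :
  reflect (exists x y, adj x y /\ f = [set x; y]) (f \in edges G).
Proof.
apply: (iffP imset2P) => [[x y _]|[x [y [xy ->]]]].
  by move=> xy ->; exists x, y.
by exists x y.
Qed.

Lemma card_edge f : f \in edges G -> #|f| = 2.
Proof.
case/edgesP=> x [y [xy ->]]; rewrite cards2.
by case: eqP xy => // ->; rewrite adj_irrefl.
Qed.

Definition incident S : {set {set G}} :=
  [set f in edges G | f :&: S != set0].

Lemma card_edges_at v : #|[set f in edges G | v \in f]| = deg v.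
Proof.
rewrite /deg -(@card_in_imset _ _ (fun x => [set v; x])).
  apply: eq_card => f; rewrite !inE; apply/andP/imsetP.
    case=> /edgesP[x [y [xy ->]]]; rewrite !inE => /orP[] /eqP ->.
      by exists y; rewrite ?inE.
    by exists x; rewrite ?inE 1?adj_sym // setUC.
  case=> x; rewrite inE => vx ->; split; last by rewrite !inE eqxx.
  by apply/edgesP; exists v, x.
(* Injectivity of [x] |-> [[set v; x]] on the neighbours of [v]: [x] lies in [[set v; y]], and
   [x = v] would be a loop. *)
move=> x y; rewrite !inE => vx _ /setP/(_ x); rewrite !inE eqxx orbT.
case: eqP vx => [->|_ _ /esym/eqP //]; by rewrite adj_irrefl.
Qed.

(** Both sides count the pairs of an edge and an endpoint of it in [S], that is, the sum of
    [#|f :&: S|] over the edges. *)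
Lemma card_incident S :
  #|incident S| + #|[set f in edges G | f \subset S]| = \sum_(x in S) deg x.
Proof.
have -> : \sum_(x in S) deg x = \sum_(f in edges G) #|f :&: S|.
  under eq_bigr do rewrite -card_edges_at -sum1_card.
  under [RHS]eq_bigr do rewrite -sum1_card.
  rewrite (exchange_big_dep (mem (edges G))) /=; last first.
    by move=> x f _; rewrite inE => /andP[].
  apply: eq_bigr => f fE; apply: eq_bigl => x.
  by rewrite !inE fE andbC.
rewrite -!sum1_card /incident.
under eq_bigl do rewrite inE; under [X in _ + X]eq_bigl do rewrite inE.
rewrite !big_mkcondr -big_split /=; apply: eq_bigr => f /card_edge f2.
(* Edge by edge, the two indicators add up to [#|f :&: S|]: this is 2 inside [S], and at most 1
   otherwise because [#|f| = 2]. *)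
have [fS|nfS] := boolP (f \subset S).
  by rewrite (setIidPl fS) -card_gt0 f2.
have : #|f :&: S| < 2.
  rewrite -f2 proper_card // properEneq subsetIl andbT.
  by apply: contra nfS => /eqP/setIidPl.
by rewrite -card_gt0; case: #|_| => [|[]].
Qed.

End Domination.

Lemma adj_del (G : sgraph) (F : {set {set G}}) (x y : G) :
  @adj (del_edges F) x y = adj x y && ([set x; y] \notin F).
Proof. by []. Qed.

Lemma gamma_del_set0 (G : sgraph) :
  gamma (del_edges (set0 : {set {set G}})) <= gamma G.
Proof.
have [D /dominatingP domD <-] := gamma_witness G.
apply: (@gamma_leq (del_edges set0) D); apply/dominatingP => x /domD[y yD xy].
by exists y => //; rewrite adj_del inE xy.
Qed.

(** Losing one edge can leave at most one vertex undominated, an endpoint of that edge; adding this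
    endpoint to the dominating set repairs it. *)
Lemma gamma_del_edge (G : sgraph) (F : {set {set G}}) (e : {set G}) :
  e \in edges G -> gamma (del_edges F) <= gamma (del_edges (F :\ e)) + 1.
Proof.
case/edgesP=> x [y [xy ->]].
have [D /dominatingP domD <-] : exists2 D : {set G},
    @dominating (del_edges (F :\ [set x; y])) D &
    #|D| = gamma (del_edges (F :\ [set x; y]))
  by exact: gamma_witness (del_edges _).
suff [a domDa] : exists a : G, @dominating (del_edges F) (a |: D).
  by rewrite (leq_trans (gamma_leq domDa)) // cardsU1 addnC leq_add2l leq_b1.
(* When x \notin D, adding x suffices: a dominator of y in D is not x, so it
   does not reach y through the edge xy. *)
wlog xD : x y xy domD / x \notin D => [wl|].
  have [xD|] := boolP (x \in D); last exact: wl xy domD.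
  have [yD|yD] := boolP (y \in D); last first.
    by apply: (wl y x) => //; [rewrite adj_sym | rewrite [[set y; x]]setUC].
  (* With both endpoints in [D], adding [x] changes nothing, and the edge [xy] dominates no vertex
     outside [D]. *)
  exists x; apply/dominatingP => z; rewrite !inE negb_or => /andP[_ zD].
  have [t tD] := domD z zD.
  rewrite adj_del => /andP[zt]; rewrite !inE negb_and negbK => ztF.
  exists t; rewrite ?inE ?tD ?orbT // adj_del zt /=.
  case/orP: ztF => // /eqP/setP/(_ z); rewrite !inE eqxx /= => /esym.
  by case/orP=> /eqP zE; rewrite zE ?xD ?yD in zD.
exists x; apply/dominatingP => z; rewrite !inE negb_or => /andP[zx zD].
have [t tD] := domD z zD.
rewrite adj_del => /andP[zt]; rewrite !inE negb_and negbK => ztF.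
exists t; rewrite ?inE ?tD ?orbT // adj_del zt /=.
case/orP: ztF => // /eqP/setP/(_ x); rewrite !inE eqxx /= eq_sym (negPf zx) /=.
by move/eqP=> xt; rewrite xt tD in xD.
Qed.

(** A discrete intermediate value argument: putting the edges of [F] back one at a time lowers
    [gamma] by at most 1 per edge and ends at most at [gamma G], so the value [gamma G + k] is not
    skipped. *)
Lemma gamma_del_exact (G : sgraph) (F : {set {set G}}) k :
    F \subset edges G -> gamma G + k <= gamma (del_edges F) ->
  exists2 F' : {set {set G}}, F' \subset F & gamma (del_edges F') = gamma G + k.
Proof.
elim/(@ltn_ind): {F}#|F| {-2}F (erefl #|F|) => n IHn F Fn FE.
rewrite leq_eqVlt => /predU1P[->|ltF]; first by exists F.
have [F0|[e eF]] := set_0Vmem F.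
  have := leq_trans ltF _; rewrite F0 => /(_ _ (gamma_del_set0 G)).
  by rewrite ltnNge leq_addr.
have FeF : F :\ e \subset F by exact: subD1set.
have [|||F' F'F <-] := IHn #|F :\ e| _ (F :\ e) (erefl _).
- by rewrite -Fn (cardsD1 e F) eF.
- exact: subset_trans FE.
- rewrite -ltnS (leq_trans ltF) // -addn1.
  by rewrite gamma_del_edge // (subsetP FE).
by exists F' => //; apply: subset_trans FeF.
Qed.

Lemma incident_isolated (G : sgraph) (S : {set G}) (x y : G) :
  x \in S -> ~~ @adj (del_edges (incident S)) x y.
Proof.
move=> xS; rewrite adj_del; apply/negP=> /andP[xy];
rewrite inE => /negP[]; apply/andP; split.
  by apply/edgesP; exists x, y.
by apply/set0Pn; exists x; rewrite !inE eqxx.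
Qed.

Lemma big_set3 (T : finType) (E : T -> nat) (u v w : T) :
  uniq [:: u; v; w] -> \sum_(x in [set u; v; w]) E x = E u + E v + E w.
Proof.
move=> Uuvw; rewrite (eq_bigl (mem [:: u; v; w])); last first.
  by move=> x; rewrite !inE orbA.
by rewrite -big_uniq //= !big_cons big_nil addn0 addnA.
Qed.

Lemma gamma_del_incident (G : sgraph) (u v w : G) :
    uniq [:: u; v; w] -> adj v u -> adj v w ->
  gamma G + 2 <= gamma (del_edges (incident [set u; v; w])).
Proof.
move=> Uuvw vu vw; set S := [set u; v; w].
have cardS : #|S| = 3 by rewrite -sum1_card big_set3.
have [D /dominatingP domD <-] := gamma_witness (del_edges (incident S)).
have SD : S \subset D.
  apply/subsetP => x xS; apply: contraT => /domD[y _].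
  by rewrite (negPf (@incident_isolated G S x y xS)).
(* [v] dominates [u] and [w]; a vertex outside [S] keeps its dominator, which is not isolated and
   hence not in [S]. *)
have domG : dominating (v |: (D :\: S)).
  apply/dominatingP => x.
  rewrite in_setU1 in_setD negb_or negb_and negbK => /andP[xv].
  have [xS _|xS] := boolP (x \in S).
    exists v; first by rewrite !inE eqxx.
    by move: xS; rewrite !inE (negPf xv) orbF => /orP[] /eqP->; rewrite adj_sym.
  move=> /= /domD[y yD xy].
  exists y; last by move: xy; rewrite adj_del => /andP[].
  have : y \notin S.
    apply/negP => yS; case/negP: (@incident_isolated G S y x yS).
    by rewrite adj_sym.
  by rewrite in_setU1 in_setD yD => ->; rewrite orbT.
have := gamma_leq domG.
rewrite cardsU1 !inE eqxx !orbT /= cardsD (setIidPr SD) cardS => leG.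
(* [3 <= #|D|] makes the truncated subtraction [#|D| - 3] exact. *)
have := subset_leq_card SD; rewrite cardS => D3.
rewrite (leq_trans (_ : _ <= 1 + (#|D| - 3) + 2)) ?leq_add2r //.
by rewrite addnAC addnC subnK.
Qed.

Theorem theorem4 (G : sgraph) :
  (Sb2 G <=
   \big[mine/+oo]_(t : G * G * G |
       let: (u, v, w) := t in [&& uniq [:: u; v; w], adj v u & adj v w])
     (let: (u, v, w) := t in
      (Posz (deg u) + Posz (deg v) + Posz (deg w) - Posz (sigma u v w))%R%:E))%E.
Proof.
apply: le_bigmin => [|[[u v] w] /and3P[Uuvw vu vw]].
  (* The default [+oo] is the right-hand side when no triple qualifies. *)
  exact: leey.
set S := [set u; v; w].
have SE : incident S \subset edges G.
  by apply/subsetP => f; rewrite inE => /andP[].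
have [F FS gF] := gamma_del_exact SE (gamma_del_incident Uuvw vu vw).
apply: (bigmin_inf F); first by rewrite gF eqxx (subset_trans FS).
(* Moving [sigma] to the left turns the integer bound into one on naturals, where [sigma] is the
   second term of [card_incident]. *)
rewrite lee_fin lerBrDr -!PoszD lez_nat -big_set3 // -card_incident.
by rewrite leq_add2r subset_leq_card.
Qed.
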